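(* Let $n,m\in\mathbb{N}$, and let $A,X,f$ satisfy: (a) $A\in\{0,1\}^{n\times m}$ has no zero column; (b) $\{\mathbf{0}_m,\mathbf{e}_1,\dots,\mathbf{e}_m\}\subseteq X\subseteq\mathbb{R}^m_+$; (c) $f:X\to\mathbb{R}$ satisfies $f(\mathbf{0}_m)=0$ and $f(x)\le\sum_{j=1}^m f(\mathbf{e}_j)x_j$ for all $x\in X$. Let $F(x)=\sum_{j=1}^m f(\mathbf{e}_j)x_j$ for $x\in\mathbb{R}^m_+$, and for $w\in\{0,1\}^n$ define $$\nu_{X,f}(w)=\max_{x\in X}[f(x):Ax\le w],\quad \nu_{X,F}(w)=\max_{x\in X}[F(x):Ax\le w],\quad \nu_{\mathbb{R}^m_+,F}(w)=\max_{x\in\mathbb{R}^m_+}[F(x):Ax\le w].$$ Then $\mathrm{core}(\nu_{X,f})$ is non-empty if and only if both of the following hold: (i) $\nu_{X,F}(\mathbf{1}_n)=\nu_{\mathbb{R}^m_+,F}(\mathbf{1}_n)$; and (ii) there exists $x^*\in\operatorname*{arg\,max}_{x\in X}[F(x):Ax\le\mathbf{1}_n]$ such that $f(x^* )=F(x^* )$.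
   Context: Notation: $\mathbf{0}_n,\mathbf{1}_n$ are the all-zero and all-one vectors in $\mathbb{R}^n$; $\mathbf{e}_j$ is the $j$-th unit vector; $\mathbb{R}^m_+$ is the set of componentwise non-negative vectors; vector inequalities are componentwise. Standing convention: the maxima defining the games are attained for every $w\in\{0,1\}^n$. The core of a (revenue) game $\nu:\{0,1\}^n\to\mathbb{R}$ is $\mathrm{core}(\nu)=\{y\in\mathbb{R}^n:\mathbf{1}_n^Ty=\nu(\mathbf{1}_n),\ a^Ty\ge\nu(a)\ \forall a\in\{0,1\}^n\}$. *)

(* Defs.v *)
From mathcomp Require Import all_boot all_order all_algebra.
From mathcomp Require Import boolp classical_sets reals.

Set Implicit Arguments.
Unset Strict Implicit.
Unset Printing Implicit Defensive.

Import Order.TTheory GRing.Theory Num.Theory.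

Local Open Scope classical_set_scope.
Local Open Scope ring_scope.

Section Games.
Variable R : realType.

Definition ones n : 'cV[R]_n := const_mx 1.

Definition unitv m (j : 'I_m) : 'cV[R]_m := delta_mx j 0.

Definition dotv n (u v : 'cV[R]_n) : R := (u^T *m v) 0 0.

Definition lev n (u v : 'cV[R]_n) : Prop := forall i, u i 0 <= v i 0.

Definition binary n m (M : 'M[R]_(n, m)) : Prop :=
  forall i j, M i j = 0 \/ M i j = 1.

Definition orthant m : set 'cV[R]_m := [set x | lev 0 x].

Definition feasible n m (A : 'M[R]_(n, m)) (X : set 'cV[R]_m) (w : 'cV[R]_n) :
  set 'cV[R]_m := [set x | X x /\ lev (A *m x) w].

Definition argmax (T : Type) (D : set T) (g : T -> R) : set T :=
  [set x | D x /\ forall z, D z -> g z <= g x].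

(* The objective is a total function of which only the values on X are used.
   [sup] is total: it is the maximum whenever [argmax] is non-empty (see
   [game_argmax]), and only the values at 0/1 vectors w are meaningful. *)
Definition game n m (A : 'M[R]_(n, m)) (X : set 'cV[R]_m)
  (g : 'cV[R]_m -> R) (w : 'cV[R]_n) : R := sup (g @` feasible A X w).

Definition maxima_attained n m (A : 'M[R]_(n, m)) (X : set 'cV[R]_m)
  (g : 'cV[R]_m -> R) : Prop :=
  forall w : 'cV[R]_n, binary w -> argmax (feasible A X w) g !=set0.

Definition core n (nu : 'cV[R]_n -> R) : set 'cV[R]_n :=
  [set y | dotv (ones n) y = nu (ones n) /\
           forall a, binary a -> nu a <= dotv a y].

Definition linear_ext m (f : 'cV[R]_m -> R) (x : 'cV[R]_m) : R :=
  \sum_(j < m) f (unitv j) * x j 0.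

Lemma game_argmax n m (A : 'M[R]_(n, m)) (X : set 'cV[R]_m)
  (g : 'cV[R]_m -> R) (w : 'cV[R]_n) (x : 'cV[R]_m) :
  argmax (feasible A X w) g x -> game A X g w = g x.
Proof.
move=> [Dx xmax]; apply/eqP; rewrite eq_le; apply/andP; split.
  by apply: ge_sup; [exists (g x), x | move=> _ [z Dz <-]; exact: xmax].
apply: ub_le_sup; last by exists x.
by exists (g x) => _ [z Dz <-]; exact: xmax.
Qed.

End Games.

(* Main.v *)
Require Import Defs.
From mathcomp Require Import all_boot all_order all_algebra.
From mathcomp Require Import boolp classical_sets reals.

Set Implicit Arguments.
Unset Strict Implicit.
Unset Printing Implicit Defensive.

Import Order.TTheory GRing.Theory Num.Theory.

Local Open Scope classical_set_scope.
Local Open Scope ring_scope.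

(** The core of the game is the set of optimal dual solutions of the linear
program that maximises F over the points x >= 0 with A x <= 1, as soon as it
is non-empty.

If y lies in the core, then testing it against the unit vectors e_i and the
columns of A, at which the game is worth at least f 0 = 0 and f e_j, gives
y >= 0 and y A >= (f e_j)_j ([core_dual_feasible]).  By weak duality
([weak_duality]) the maximum of F over the whole orthant is at most
y 1 = nu_(X,f)(1), which is at most nu_(X,F)(1), because f <= F on X.  Hence
the three values agree, and a maximiser of f is also one of F, at which f and F
coincide.

Conversely, strong duality ([strong_duality]) provides an optimal dual solution
y.  Weak duality bounds F, hence f, on the points of X feasible for w by y w,
and conditions (i) and (ii) say that the total y 1 is exactly nu_(X,f)(1).  So y
lies in the core.

Strong duality comes from the lemma of Farkas ([farkas]) applied to the
homogenised program, and that lemma is proved by induction on the number of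
inequalities, over any ordered field.  Componentwise inequalities u <= v between
matrices are written [v - u \is a mxOver Num.nneg]. *)

(** * Linear programming duality over an ordered field *)

Section Duality.
Context {R : realFieldType}.

Lemma nneg_mx11 (M : 'M[R]_1) : (M \is a mxOver Num.nneg) = (0 <= M 0 0).
Proof.
apply/mxOverP/idP => [/(_ 0 0) //|M0 i j].
by rewrite !ord1 nnegrE.
Qed.

Lemma nneg_mxD p q (M N : 'M[R]_(p, q)) :
  M \is a mxOver Num.nneg -> N \is a mxOver Num.nneg ->
  M + N \is a mxOver Num.nneg.
Proof.
by move=> /mxOverP M0 /mxOverP N0; apply/mxOverP => i j; rewrite mxE rpredD.
Qed.

Lemma col_mx_nneg p q r (M : 'M[R]_(p, r)) (N : 'M[R]_(q, r)) :
  (col_mx M N \is a mxOver Num.nneg) =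
  (M \is a mxOver Num.nneg) && (N \is a mxOver Num.nneg).
Proof.
apply/mxOverP/andP => [MN|[/mxOverP M0 /mxOverP N0] i j].
  split; apply/mxOverP => i j.
    by have := MN (lshift q i) j; rewrite col_mxEu.
  by have := MN (rshift p i) j; rewrite col_mxEd.
by rewrite mxE; case: splitP.
Qed.

Lemma row_mx_nneg p q r (M : 'M[R]_(r, p)) (N : 'M[R]_(r, q)) :
  (row_mx M N \is a mxOver Num.nneg) =
  (M \is a mxOver Num.nneg) && (N \is a mxOver Num.nneg).
Proof.
apply/mxOverP/andP => [MN|[/mxOverP M0 /mxOverP N0] i j].
  split; apply/mxOverP => i j.
    by have := MN i (lshift q j); rewrite row_mxEl.
  by have := MN i (rshift p j); rewrite row_mxEr.
by rewrite mxE; case: splitP.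
Qed.

(** Lemma of Farkas: a linear form that is non-negative wherever the k rows of
[a] are is a non-negative combination of these rows.  In the induction on k, if
the first row r cannot be dropped, there is a point z at which the form is
negative, the other rows are non-negative and r is -1; the induction hypothesis
is applied to the compositions with the projection x |-> x + (r x) z onto the
kernel of r. *)
Lemma farkas k p (a : 'M[R]_(k, p)) (b : 'rV[R]_p) :
  (forall x : 'cV[R]_p, a *m x \is a mxOver Num.nneg ->
     b *m x \is a mxOver Num.nneg) ->
  exists2 l : 'rV[R]_k, l \is a mxOver Num.nneg & b = l *m a.
Proof.
elim: k a b => [|k IH] a b ab.
  exists 0; first exact: thinmxOver.
  rewrite mul0mx; apply/rowP => j; rewrite mxE; apply/eqP.
  have bE (x : 'cV_p) : (b *m x) 0 0 >= 0 by rewrite -nneg_mx11; exact/ab/flatmxOver.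
  have bj : b 0 j = (b *m (delta_mx j 0 : 'cV_p)) 0 0 by rewrite -colE mxE.
  rewrite eq_le bj bE andbT -oppr_ge0.
  by have := bE (- delta_mx j 0); rewrite mulmxN mxE.
rewrite -[k.+1]/(1 + k)%N in a ab *.
set r := usubmx a; set a' := dsubmx a.
have aE : a = col_mx r a' by rewrite vsubmxK.
have [all|/existsNP[z0 /not_implyP[a'z0 /negP bz0]]] := pselect
    (forall x : 'cV[R]_p, a' *m x \is a mxOver Num.nneg ->
      b *m x \is a mxOver Num.nneg).
  have [l l0 bE] := IH _ _ all.
  exists (row_mx 0 l); first by rewrite row_mx_nneg l0 mxOver0 ?rpred0.
  by rewrite aE mul_row_col mul0mx add0r.
have rz0 : (r *m z0) 0 0 < 0.
  rewrite ltNge -nneg_mx11; apply: contra bz0 => rz0.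
  by apply: ab; rewrite aE mul_col_mx col_mx_nneg rz0.
pose s := - ((r *m z0) 0 0)^-1.
have s0 : 0 < s by rewrite oppr_gt0 invr_lt0.
pose z := s *: z0.
have a'z : a' *m z \is a mxOver Num.nneg.
  by rewrite -scalemxAr mxOverZ // nnegrE ltW.
have rz : r *m z = - 1%:M.
  rewrite -scalemxAr [r *m z0]mx11_scalar scale_scalar_mx /s mulNr mulVf.
    by rewrite raddfN.
  by rewrite lt_eqF.
have bz : (b *m z) 0 0 <= 0.
  rewrite -scalemxAr mxE pmulr_rle0 //.
  by move: bz0; rewrite nneg_mx11 -ltNge => /ltW.
have [|l l0 lE] := IH (a' + a' *m z *m r) (b + b *m z *m r).
  move=> x; rewrite !mulmxDl -!(mulmxA _ _ x) -!(mulmxA _ z) -!mulmxDr => a'y.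
  apply: ab; rewrite aE mul_col_mx col_mx_nneg a'y andbT.
  by rewrite mulmxDr [r *m (z *m _)]mulmxA rz mulNmx mul1mx subrr mxOver0 ?rpred0.
exists (row_mx (l *m (a' *m z) - b *m z) l).
  rewrite row_mx_nneg l0 andbT nneg_mx11 mxE [X in _ + X]mxE addr_ge0 ?oppr_ge0 //.
  by rewrite -nneg_mx11 mxOverM.
apply: (addIr (b *m z *m r)).
by rewrite lE aE mul_row_col mulmxBl addrAC subrK mulmxDr mulmxA addrC.
Qed.

Lemma weak_duality n m (A : 'M[R]_(n, m)) (c : 'rV[R]_m) (w : 'cV[R]_n)
    (x : 'cV[R]_m) (y : 'rV[R]_n) :
  x \is a mxOver Num.nneg -> w - A *m x \is a mxOver Num.nneg ->
  y \is a mxOver Num.nneg -> y *m A - c \is a mxOver Num.nneg ->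
  (c *m x) 0 0 <= (y *m w) 0 0.
Proof.
move=> x0 xw y0 yc.
have : y *m (w - A *m x) + (y *m A - c) *m x \is a mxOver Num.nneg.
  by apply: nneg_mxD; exact: mxOverM.
rewrite mulmxBr mulmxBl mulmxA addrA subrK nneg_mx11 mxE [X in _ + X]mxE.
by rewrite subr_ge0.
Qed.

(** The maximum of c x over x >= 0 and A x <= w, once attained, is the value y w
of some y >= 0 with y A >= c. *)
Lemma strong_duality n m (A : 'M[R]_(n, m)) (c : 'rV[R]_m) (w : 'cV[R]_n)
    (x0 : 'cV[R]_m) :
  x0 \is a mxOver Num.nneg -> w - A *m x0 \is a mxOver Num.nneg ->
  (forall x : 'cV[R]_m, x \is a mxOver Num.nneg ->
     w - A *m x \is a mxOver Num.nneg -> (c *m x) 0 0 <= (c *m x0) 0 0) ->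
  exists y : 'rV[R]_n, [/\ y \is a mxOver Num.nneg,
    y *m A - c \is a mxOver Num.nneg & (y *m w) 0 0 = (c *m x0) 0 0].
Proof.
move=> x0_ge0 x0w x0max.
(* Homogenisation: t >= 0, x >= 0 and A x <= t w imply c x <= t (c x0). *)
have [z|l] := farkas (a := col_mx 1%:M (row_mx w (- A)))
                     (b := row_mx (c *m x0) (- c)).
  rewrite -[z]vsubmxK; move: (usubmx z) (dsubmx z) => t x.
  rewrite mul_col_mx mul1mx !mul_row_col !mulNmx !col_mx_nneg nneg_mx11.
  rewrite [t]mx11_scalar; move: (t 0 0) => {z}{}t.
  rewrite !mul_mx_scalar !mxE eqxx mulr1n => /andP[/andP[t0 x_ge0] xw].
  rewrite nneg_mx11 !mxE subr_ge0.
  move: t0; rewrite le_eqVlt => /predU1P[t0|t0].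
    (* For t = 0, x is a direction of recession. *)
    move: xw; rewrite -t0 scale0r add0r mul0r => xw.
    have := x0max (x0 + x) (nneg_mxD x0_ge0 x_ge0).
    rewrite mulmxDr opprD addrA => /(_ (nneg_mxD x0w xw)).
    by rewrite mulmxDr mxE gerDl mxE.
  have ti0 : t^-1 \is Num.nneg by rewrite nnegrE invr_ge0 ltW.
  have := x0max (t^-1 *: x); rewrite mxOverZ //.
  have -> : w - A *m (t^-1 *: x) = t^-1 *: (t *: w - A *m x).
    by rewrite scalerBr scalerA mulVf ?gt_eqF // scale1r scalemxAr.
  rewrite mxOverZ // => /(_ isT isT).
  by rewrite -scalemxAr !mxE ler_pdivrMl.
rewrite -[l]hsubmxK; move: (lsubmx l) (rsubmx l) => {l} l y.
rewrite row_mx_nneg mul_row_col mulmx1 mul_mx_row mulmxN => /andP[l0 y0].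
rewrite -[l]hsubmxK add_row_mx in l0 * => /eq_row_mx[lv lc].
move: l0; rewrite row_mx_nneg => /andP[v0 c0].
have yc : y *m A - c \is a mxOver Num.nneg by rewrite lc addrC subrK.
exists y; split=> //; apply/eqP; rewrite eq_le (weak_duality x0_ge0 x0w y0 yc).
by rewrite lv [X in _ <= X]mxE lerDr -nneg_mx11 v0.
Qed.

End Duality.

(** * Core elements are dual solutions *)

Section Core.
Context {R : realType} {n m : nat}.
Implicit Types (A : 'M[R]_(n, m)) (X : set 'cV[R]_m) (f g : 'cV[R]_m -> R).

Lemma lev_nneg k (u v : 'cV[R]_k) : lev u v <-> v - u \is a mxOver Num.nneg.
Proof.
split=> [uv|/mxOverP uv i].
  by apply/mxOverP => i j; rewrite ord1 !mxE nnegrE subr_ge0; exact: uv.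
by have := uv i 0; rewrite !mxE nnegrE subr_ge0.
Qed.

Lemma orthant_nneg k (x : 'cV[R]_k) :
  orthant (m := k) x <-> x \is a mxOver Num.nneg.
Proof. by rewrite -{2}[x]subr0; exact: lev_nneg. Qed.

Lemma dotvE k (u v : 'cV[R]_k) : dotv u v = (v^T *m u) 0 0.
Proof. by rewrite /dotv -[u in RHS]trmxK -trmx_mul [RHS]mxE. Qed.

(** The row of the coefficients f e_j of [linear_ext f]. *)
Definition unit_values f : 'rV[R]_m := \row_j f (unitv R j).

Lemma linear_extE f (x : 'cV[R]_m) : linear_ext f x = (unit_values f *m x) 0 0.
Proof. by rewrite mxE; apply: eq_bigr => j _; rewrite mxE. Qed.

Lemma le_game A X g (w : 'cV[R]_n) (x : 'cV[R]_m) :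
  maxima_attained A X g -> binary w -> feasible A X w x -> g x <= game A X g w.
Proof.
move=> att w01 xw; have [z zmax] := att w w01.
by rewrite (game_argmax zmax); exact: zmax.2.
Qed.

Lemma game_le A X g (w : 'cV[R]_n) (v : R) :
  maxima_attained A X g -> binary w ->
  (forall x, feasible A X w x -> g x <= v) -> game A X g w <= v.
Proof.
move=> att w01 gv; have [z zmax] := att w w01.
by rewrite (game_argmax zmax); apply: gv; exact: zmax.1.
Qed.

Lemma binary_ones : binary (ones R n).
Proof. by move=> i j; right; rewrite mxE. Qed.

(** The values of the game at e_i and at column j of A bound y_i and (y A)_j from
below, since 0 is feasible for the former and e_j for the latter. *)
Lemma core_dual_feasible A X f (y : 'cV[R]_n) :
  binary A -> X 0 -> (forall j, X (unitv R j)) -> f 0 = 0 ->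
  maxima_attained A X f -> core (game A X f) y ->
  y^T \is a mxOver Num.nneg /\ y^T *m A - unit_values f \is a mxOver Num.nneg.
Proof.
move=> A01 X0 Xe f0 att [_ ycore]; split; apply/mxOverP => i j; rewrite nnegrE.
  rewrite ord1 mxE -f0.
  have e01 : binary (unitv R j).
    by move=> k l; rewrite mxE; case: andP => _; [right|left].
  have -> : y j 0 = dotv (unitv R j) y by rewrite dotvE -colE !mxE.
  apply: le_trans (ycore _ e01); apply: le_game => //; split=> // k.
  by rewrite mulmx0 !mxE ler0n.
rewrite ord1 !mxE subr_ge0.
have a01 : binary (col j A) by move=> k l; rewrite mxE.
have -> : \sum_k y^T 0 k * A k j = dotv (col j A) y.
  by rewrite dotvE mxE; apply: eq_bigr => k _; rewrite !mxE.
apply: le_trans (ycore _ a01); apply: le_game => //; split=> // k.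
by rewrite /unitv -colE.
Qed.

End Core.

(** * Non-emptiness of the core *)

Theorem theorem2 (R : realType) (n m : nat) (A : 'M[R]_(n, m))
    (X : set 'cV[R]_m) (f : 'cV[R]_m -> R)
    (A_binary : binary A)
    (A_col : forall j : 'I_m, col j A <> 0)
    (X_zero : X 0)
    (X_unit : forall j : 'I_m, X (unitv R j))
    (X_nonneg : X `<=` orthant (m := m))
    (f_zero : f 0 = 0)
    (f_le : forall x, X x -> f x <= \sum_(j < m) f (unitv R j) * x j 0)
    (attained_Xf : maxima_attained A X f)
    (attained_XF : maxima_attained A X (linear_ext f))
    (attained_RF : maxima_attained A (orthant (m := m)) (linear_ext f)) :
  core (game A X f) !=set0 <->
  (game A X (linear_ext f) (ones R n) =
     game A (orthant (m := m)) (linear_ext f) (ones R n) /\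
   exists xstar : 'cV[R]_m,
     argmax (feasible A X (ones R n)) (linear_ext f) xstar /\
     f xstar = linear_ext f xstar).
Proof.
pose F := linear_ext f; pose R_ := orthant (R := R) (m := m).
have one01 : binary (ones R n) by exact: binary_ones.
have fF x : X x -> f x <= F x by exact: f_le.
have X_R x : feasible A X (ones R n) x -> feasible A R_ (ones R n) x.
  by move=> [Xx xw]; split=> //; exact: X_nonneg.
split=> [[y ycore]|[valE [xs [xs_max fFxs]]]].
  have [y0 yc] := core_dual_feasible A_binary X_zero X_unit f_zero attained_Xf ycore.
  have [x xmax] := attained_Xf _ one01; have Xx := xmax.1.1.
  have R_le : game A R_ F (ones R n) <= f x.
    apply: game_le => // z [/orthant_nneg z0 /lev_nneg zw].
    rewrite -(game_argmax xmax) -ycore.1 /F linear_extE dotvE.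
    exact: weak_duality z0 zw y0 yc.
  have X_le : game A X F (ones R n) <= game A R_ F (ones R n).
    by apply: game_le => // z /X_R; exact: le_game.
  have x_le : F x <= game A X F (ones R n) by apply: le_game => //; exact: xmax.1.
  have fFx : f x = F x.
    apply/eqP; rewrite eq_le fF //=.
    exact: le_trans x_le (le_trans X_le R_le).
  split; last first.
    exists x; split=> //; split=> [|z zw]; first exact: xmax.1.
    rewrite -/F -fFx; apply: le_trans R_le; apply: le_trans X_le.
    exact: le_game.
  apply/eqP; rewrite eq_le X_le /=.
  by apply: le_trans x_le; rewrite -fFx.
have [x xmax] := attained_RF _ one01.
have [/orthant_nneg x0 /lev_nneg xw] := xmax.1.
have [|y [y0 yc yE]] := strong_duality (c := unit_values f) x0 xw.
  move=> z /orthant_nneg z0 /lev_nneg zw; rewrite -!linear_extE.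
  by apply: xmax.2.
exists y^T; split=> [|a a01].
  rewrite dotvE trmxK yE -linear_extE -(game_argmax xmax) -valE (game_argmax xs_max) -fFxs.
  rewrite (@game_argmax _ _ _ _ _ _ _ xs) //; split; first exact: xs_max.1.
  move=> z zw; rewrite fFxs; apply: le_trans (xs_max.2 z zw).
  exact: fF zw.1.
apply: game_le => // z [Xz /lev_nneg zw]; apply: le_trans (fF z Xz) _.
rewrite /F linear_extE dotvE trmxK; apply: weak_duality zw y0 yc.
by apply/orthant_nneg; exact: X_nonneg.
Qed.
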